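(* For all integers $m\ge1$ and $p\ge1$, $$\langle K_m,p\rangle=\langle K_{m-2},P(b,p)+1\rangle\cup\langle K_{m-1},P(a,p)+1\rangle .$$
   Context: The Fibonacci sequence $\mathbb{F}$ is the infinite word over $\{a,b\}$ that is the fixed point beginning with $a$ of the morphism $\sigma(a)=ab$, $\sigma(b)=a$; positions are numbered from $1$. Put $F_{-1}=b$ and $F_m=\sigma^m(a)$ for $m\ge0$, and let $\delta_m$ be the last letter of $F_m$ ($m\ge-1$). The $m$-th kernel word ($m\ge-1$) is $K_m=\delta_{m+1}F_m\delta_m^{-1}$, i.e. delete the last letter of $F_m$ and put the letter $\delta_{m+1}$ in front; thus $K_{-1}=a$, $K_0=b$, $K_1=aa$, $K_2=bab$, and so on. For a nonempty factor $\omega$ of $\mathbb{F}$, $Ker(\omega)$ is the maximal kernel word occurring in $\omega$, i.e. the $K_m$ of largest index $m$ that is a factor of $\omega$. For a factor $\omega$ and $p\ge1$, $P(\omega,p)$ is the position of the last letter of the $p$-th occurrence of $\omega$ in $\mathbb{F}$. $\mathcal{P}_F$ is the set of nonempty palindromes occurring as factors of $\mathbb{F}$. For $m\ge-1$, $p\ge1$, $\langle K_m,p\rangle=\{P(\omega,p):\omega\in\mathcal{P}_F,\ Ker(\omega)=K_m\}$. *)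

(* Defs.v *)
From HB Require Import structures.
From mathcomp Require Import all_boot all_order all_algebra.
From mathcomp Require Import zify.
From mathcomp Require Import boolp classical_sets.
Set Implicit Arguments.
Unset Strict Implicit.
Unset Printing Implicit Defensive.
Import Order.TTheory GRing.Theory Num.Theory.

Inductive letter := a | b.

Definition bool_of_letter x := if x is a then true else false.
Definition letter_of_bool c := if c is true then a else b.
Lemma bool_of_letterK : cancel bool_of_letter letter_of_bool.
Proof. by case. Qed.
HB.instance Definition _ := Finite.copy letter (can_type bool_of_letterK).

Notation word := (seq letter).

Definition sigma (w : word) : word :=
  flatten [seq if x is a then [:: a; b] else [:: a] | x <- w].

(* F_m for m >= -1; the value b is also taken, irrelevantly, for m < -1. *)
Definition Fword (m : int) : word :=
  match m with
  | Posz n => iter n sigma [:: a]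
  | Negz _ => [:: b]
  end.

(* Infinite words are maps nat -> letter with positions starting at 1; the
   value at 0 is never used. *)
Definition pref (u : nat -> letter) (n : nat) : word :=
  [seq u i | i <- iota 1 n].

Definition sigma_fixed (u : nat -> letter) : Prop :=
  forall n, sigma (pref u n) = pref u (size (sigma (pref u n))).

(* The n-th letter of the Fibonacci sequence, read off sigma^n(a), which has
   length at least n. The lemmas fib_fixed and fib_unique below show that this
   is the fixed point of sigma beginning with a. *)
Definition fib (n : nat) : letter := nth a (Fword n%:Z) n.-1.

(* The words F_m are nonempty, so the default letter a is never used. *)
Definition delta (m : int) : letter := last a (Fword m).

Definition K (m : int) : word :=
  delta (m + 1)%R :: take (size (Fword m)).-1 (Fword m).

(* An occurrence of w in the Fibonacci sequence whose last letter is at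
   position n. *)
Definition ends_at (w : word) (n : nat) : bool :=
  (size w <= n) && (w == [seq fib i | i <- iota (n - size w).+1 (size w)]).

Definition factor (w : word) : Prop := exists n, ends_at w n.

(* The position n at which w ends and up to which exactly p occurrences of w
   have ended. Every factor of the Fibonacci sequence occurs infinitely often,
   so the default value 0 is not reached for a nonempty factor w and p >= 1. *)
Definition P (w : word) (p : nat) : nat :=
  xget 0 [set n : nat | ends_at w n /\ count (ends_at w) (iota 1 n) = p].

(* A nonempty word contains K_(-1) = a or K_0 = b, and the length of K_m tends
   to infinity, so the default value [::] is not reached for nonempty w. *)
Definition Ker (w : word) : word :=
  xget [::] [set v : word | exists m : int,
    [/\ (-1 <= m)%R, infix (K m) w,
        forall k : int, (-1 <= k)%R -> infix (K k) w -> (k <= m)%R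
      & v = K m]].

Definition palF : set word :=
  [set w : word | [/\ w <> [::], factor w & rev w = w]].

Definition kset (m : int) (p : nat) : set nat :=
  [set P w p | w in [set w : word | palF w /\ Ker w = K m]].

Lemma sigma_cat u v : sigma (u ++ v) = sigma u ++ sigma v.
Proof. by rewrite /sigma map_cat flatten_cat. Qed.

Lemma size_sigma w : size w <= size (sigma w).
Proof.
elim: w => //= x w IH; rewrite /sigma /= size_cat -/(sigma w).
by case: x => /=; lia.
Qed.

Lemma prefix_sigma u v : prefix u v -> prefix (sigma u) (sigma v).
Proof. by case/prefixP=> s ->; rewrite sigma_cat prefix_prefix. Qed.

Lemma Fword_head (n : nat) : exists s, Fword n%:Z = a :: s.
Proof.
elim: n => [|n [s E]]; first by exists [::].
by exists (b :: sigma s); rewrite [LHS](_ : _ = sigma (Fword n%:Z)) // E.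
Qed.

Lemma Fword_prefixS (n : nat) : prefix (Fword n%:Z) (Fword n.+1%:Z).
Proof. by elim: n => // n IH; apply: prefix_sigma IH. Qed.

Lemma Fword_prefix (m n : nat) : m <= n -> prefix (Fword m%:Z) (Fword n%:Z).
Proof.
elim: n => [|n IH]; first by case: m.
rewrite leq_eqVlt => /orP[/eqP-> | /IH mn]; first exact: prefix_refl.
exact: prefix_trans mn (Fword_prefixS n).
Qed.

Lemma size_Fword (n : nat) : n < size (Fword n%:Z).
Proof.
elim: n => // n IH; rewrite (_ : Fword n.+1%:Z = sigma (Fword n%:Z)) //.
have [s E] := Fword_head n; rewrite E in IH *.
by have := size_sigma s; rewrite /sigma /= -/(sigma s) in IH *; lia.
Qed.

Lemma size_pref u n : size (pref u n) = n.
Proof. by rewrite size_map size_iota. Qed.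

Lemma nth_pref u n i : i < n -> nth a (pref u n) i = u i.+1.
Proof. by move=> ltin; rewrite (nth_map 0) ?size_iota // nth_iota. Qed.

Lemma nth_prefix (u v : word) i :
  prefix u v -> i < size u -> nth a v i = nth a u i.
Proof. by case/prefixP=> s -> lti; rewrite nth_cat lti. Qed.

Lemma fib_pref (n : nat) : pref fib (size (Fword n%:Z)) = Fword n%:Z.
Proof.
apply: (@eq_from_nth _ a); rewrite size_pref // => i lti.
rewrite nth_pref // /fib /=.
have lti' : i < size (Fword i.+1%:Z) := ltnW (size_Fword i.+1).
have [le|/ltnW le] := leqP i.+1 n.
  by rewrite (nth_prefix (Fword_prefix le)).
by rewrite (nth_prefix (Fword_prefix le)).
Qed.

Lemma pref_prefix u m n : m <= n -> prefix (pref u m) (pref u n).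
Proof.
move=> mn; rewrite /pref -(subnKC mn) iotaD map_cat; exact: prefix_prefix.
Qed.

Lemma fib_fixed : sigma_fixed fib.
Proof.
move=> n; have szn := size_Fword n.
have := prefix_sigma (pref_prefix fib (ltnW szn)); rewrite fib_pref.
rewrite (_ : sigma (Fword n%:Z) = Fword n.+1%:Z) // -fib_pref => pn.
apply: (@eq_from_nth _ a) => [|i lti]; first by rewrite size_pref.
have le := size_prefix pn; rewrite [leqRHS]size_pref in le.
by rewrite nth_pref // -(nth_prefix pn) // nth_pref // (leq_trans lti).
Qed.

Lemma fib_unique u : sigma_fixed u -> u 1 = a -> forall n, 0 < n -> u n = fib n.
Proof.
move=> fu u1; have E (n : nat) : pref u (size (Fword n%:Z)) = Fword n%:Z.
  elim: n => [|n IH]; first by rewrite /= /pref /= u1.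
  have := fu (size (Fword n%:Z)); rewrite IH.
  by rewrite (_ : sigma (Fword n%:Z) = Fword n.+1%:Z).
case=> // n _; have lt : n < size (Fword n.+1%:Z) := ltnW (size_Fword n.+1).
by rewrite -(nth_pref u lt) E.
Qed.

(* Main.v *)
Require Import Defs.
From mathcomp Require Import all_boot all_order all_algebra.
From mathcomp Require Import boolp classical_sets.
From mathcomp Require Import zify.
Set Implicit Arguments.
Unset Strict Implicit.
Unset Printing Implicit Defensive.
Import Order.TTheory GRing.Theory Num.Theory.

(* Put psi w = sigma w ++ [:: a] and L n = |sigma (x_1 ... x_n)|, where x is the
   Fibonacci word. By unique desubstitution, the occurrences of psi w end
   exactly at the positions L n + 1, n an end of an occurrence of w. Moreover
   psi preserves palindromes, and psi K_m is K_(m+1) or a K_(m+1) a according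
   to the parity of m, so K_(k+1) occurs in psi w iff K_k occurs in w. Hence
   the palindromes with kernel K_(m+1) are the psi v, and the psi v stripped of
   both end letters when these give a word b...b, for v a palindrome with kernel
   K_m. This says that <K_(m+1),p> = T <K_m,p> for a map T on sets of positions
   that commutes with unions, and the recurrence follows by induction from the
   case m = 1, which reduces to P(a,n+1) = L n + 1 and P(b,p) = L (P(a,p)). *)

(** * Desubstitution for [psi] *)

Definition psi (w : word) : word := sigma w ++ [:: a].

Lemma sigma_cons x w :
  sigma (x :: w) = (if x is a then [:: a; b] else [:: a]) ++ sigma w.
Proof. by []. Qed.

Lemma psi_cat u v : psi (u ++ v) = sigma u ++ psi v.
Proof. by rewrite /psi sigma_cat catA. Qed.

Lemma psi_head w : exists t, psi w = a :: t.
Proof. by case: w => [|[] w]; rewrite /psi ?sigma_cons; eexists. Qed.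

(** Each [a] in [psi w] is the final one or begins the image of a letter, so a cut before an [a]
    never splits an image. *)
Lemma psi_cut w s t : psi w = s ++ a :: t ->
  exists w1 w2, [/\ w = w1 ++ w2, s = sigma w1 & a :: t = psi w2].
Proof.
elim: w s => [|x w IH] s.
  case: s => [|y s] /=; first by exists [::], [::].
  by case=> _; case: s.
case: s => [|y s] E; first by exists [::], (x :: w).
case: x E => /=; rewrite /psi sigma_cons.
  case: s => [|z s] //= [<- <-] /IH [w1 [w2 [-> -> ->]]].
  by exists (a :: w1), w2.
move=> /= [<- /IH [w1 [w2 [-> -> ->]]]].
by exists (b :: w1), w2.
Qed.

(** An [a] comes from [sigma [:: a]] or [sigma [:: b]] according as [b] follows or not; the [a]
    after [sigma v] settles its last letter too. *)
Lemma psi_strip w v t : psi w = sigma v ++ a :: t ->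
  exists w2, w = v ++ w2 /\ a :: t = psi w2.
Proof.
elim: v w => [|x v IH] w; first by move=> E; exists w.
case: w => [|y w].
  by case: x; rewrite sigma_cons //= => -[]; case: sigma.
have [h E] := psi_head w; have [h' E'] := psi_head v.
case: x; case: y; rewrite /psi !sigma_cons /=.
- by case=> /IH [w2 [-> ->]]; exists w2.
- by case; rewrite -/(psi w) E.
- case; case: (v) => [|[] v'] //=.
- by case=> /IH [w2 [-> ->]]; exists w2.
Qed.

Lemma psi_inj : injective psi.
Proof.
move=> v w E; have := E; rewrite {2}/psi => /psi_strip [v' [E' _]].
move: E; rewrite E' psi_cat /psi => /(congr1 size).
have := size_sigma v'; rewrite !size_cat /= => ? ?.
have : size v' = 0 by lia.
by move/size0nil => ->; rewrite cats0.
Qed.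

(** The images [aba] and [aa] of single letters under [psi] are palindromes. *)
Lemma rev_psi w : rev (psi w) = psi (rev w).
Proof.
elim: w => // x w IH.
rewrite rev_cons -cats1 psi_cat /psi !sigma_cons -!catA rev_cat -/(psi w) IH.
by case: x; rewrite /psi /= -!catA.
Qed.

Lemma psi_before_b w s t : psi w = s ++ b :: t -> exists s', s = rcons s' a.
Proof.
elim: w s => [|x w IH] s; first by case: s => [|? []].
case: s => [|y s]; first by case: x.
case: x; rewrite /psi sigma_cons /=.
  case: s => [|z s] [<-]; first by exists [::].
  by move=> <- /IH [s' ->]; exists [:: a, b & s'].
by move=> [<- /IH [s' ->]]; exists (a :: s').
Qed.

Lemma psi_after_b w s t : psi w = s ++ b :: t -> exists t', t = a :: t'.
Proof.
move=> E; have := congr1 rev E; rewrite rev_psi rev_cat rev_cons cat_rcons.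
case/psi_before_b => t' /(congr1 rev); rewrite revK rev_rcons => ->.
by exists (rev t').
Qed.

Lemma infix_psi v w : infix (psi v) (psi w) = infix v w.
Proof.
apply/infixP/infixP => -[s [t]].
  have [h E] := psi_head v; rewrite E cat_cons.
  move/psi_cut => [w1 [w2 [-> _]]].
  rewrite -cat_cons -E /psi -catA => /esym /psi_strip [w3 [-> _]].
  by exists w1, w3.
move=> ->; have [h E] := psi_head t; exists (sigma s), h.
by rewrite !psi_cat E /psi -catA.
Qed.

(** * Kernel words and their occurrences *)

Lemma KintS (j : nat) : (j.+1%:Z - 1 = j%:Z)%R.
Proof. lia. Qed.

(* Indices shifted by one, so that they are natural numbers: Kn j = K_(j-1). *)
Definition Fw (j : nat) := Fword (j%:Z - 1)%R.
Definition Kn (j : nat) := K (j%:Z - 1)%R.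

Lemma FwS j : Fw j.+1 = sigma (Fw j).
Proof. by case: j => [|j]; rewrite /Fw !KintS. Qed.

Lemma last_Fw j : exists s, Fw j = rcons s (if odd j then a else b).
Proof.
elim: j => [|j [s E]]; first by exists [::].
rewrite FwS E -cats1 sigma_cat /=; case: (odd j) => /=.
  by exists (rcons (sigma s) a); rewrite -!cats1 -catA.
by exists (sigma s); rewrite -cats1.
Qed.

(** Restoring the deleted letter gives an identity of concatenations, to which [sigma] can be
    applied. *)
Lemma Kn_Fw j :
  rcons (Kn j) (if odd j then a else b) = (if odd j then b else a) :: Fw j.
Proof.
have [s E] := last_Fw j; have [s' E'] := last_Fw j.+1.
rewrite /Kn /K /delta (_ : (j%:Z - 1 + 1)%R = (j.+1%:Z - 1)%R); last lia.
rewrite -/(Fw j) -/(Fw j.+1) E' E last_rcons size_rcons.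
rewrite -[X in take _ X]cats1 take_size_cat //.
by rewrite /=; case: (odd j).
Qed.

Lemma sigma_rcons s x : sigma (rcons s x) = sigma s ++ sigma [:: x].
Proof. by rewrite -cats1 sigma_cat. Qed.

Lemma KnE j : K (j%:Z - 1)%R = Kn j.
Proof. by []. Qed.

Lemma Kn0 : Kn 0 = [:: a].
Proof. by []. Qed.

Lemma Kn1 : Kn 1 = [:: b].
Proof. by []. Qed.

Lemma Kn2 : Kn 2 = [:: a; a].
Proof. by []. Qed.

Lemma Kn_neq0 j : Kn j <> [::].
Proof. by []. Qed.

(* Otherwise unification unfolds Kn into a cons. *)
Opaque Kn.

(** Apply [sigma] to [Kn_Fw] for [j] and compare with [Kn_Fw] for [j.+1]; for odd [j] a common final
    [b] cancels. *)
Lemma KnS j : psi (Kn j) = if odd j then Kn j.+1 else a :: rcons (Kn j.+1) a.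
Proof.
have := Kn_Fw j.+1; have := congr1 sigma (Kn_Fw j); rewrite FwS oddS.
move: (Kn j) (Kn j.+1) (Fw j) => k k' f.
rewrite sigma_rcons !sigma_cons /psi.
case: (odd j) => /= E1 E2; last by rewrite E2 -E1.
by apply: (@rcons_injl _ b); rewrite E2 -cats1 -catA.
Qed.


Lemma rev_Kn j : rev (Kn j) = Kn j.
Proof.
elim: j => [|j IH]; first by rewrite Kn0.
have := rev_psi (Kn j); rewrite IH KnS.
move: (Kn j.+1) => k; case: (odd j) => //.
by rewrite rev_cons rev_rcons rcons_cons; case=> E; apply: (@rcons_injl _ a).
Qed.


Lemma Kn_odd_head j : odd j -> exists s, Kn j = b :: s.
Proof.
move=> oj; have := Kn_Fw j; rewrite oj; case: (Kn j) => [|x s] /=.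
  by case.
by case=> -> _; exists s.
Qed.

Lemma Kn_even_head j : ~~ odd j -> 0 < j -> exists s, Kn j = [:: a, a & s].
Proof.
case: j => [|[|j]] // oj _; have := Kn_Fw j.+2; rewrite (negbTE oj).
have [s ->] : exists s, Fw j.+2 = [:: a, b & s].
  by rewrite FwS /Fw KintS; have [s ->] := Fword_head j; exists (sigma s).
by case: (Kn j.+2) => [|x [|y t]] //= [-> -> _]; exists t.
Qed.

(** [Kn j.+1] begins with [b] or [aa], the longer word with [ab]. By symmetry an occurrence can
    touch neither end. *)
Lemma infix_Kn_cons_rcons j w s : rev w = w -> w = b :: s ->
  infix (Kn j.+1) (a :: rcons w a) = infix (Kn j.+1) w.
Proof.
move=> rw Ew; apply/infixP/infixP => -[u [v]] E; last first.
  by exists (a :: u), (rcons v a); rewrite E !rcons_cat.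
have noprefix t v' : a :: b :: t <> Kn j.+1 ++ v'.
  have [oj|oj] := boolP (odd j.+1).
    by have [k ->] := Kn_odd_head oj.
  by have [k ->] := Kn_even_head oj isT.
case: u E => [|x u] E.
  by case: (@noprefix (rcons s a) v); rewrite -[RHS]E Ew.
case/lastP: v E => [|v y] E.
  case: (@noprefix (rcons s a) (rev (x :: u))).
  rewrite -[X in X ++ _]rev_Kn -rev_cat -[Kn _]cats0 -E.
  by rewrite rev_cons rev_rcons rw Ew.
move: E; rewrite cat_cons => -[_]; rewrite -!rcons_cat  => /rcons_inj [-> _].
by exists u, v.
Qed.

Lemma infix_Kn_psi j w : infix (Kn j.+1) (psi w) = infix (Kn j) w.
Proof.
rewrite -(infix_psi _ w) KnS; case: ifP => // /negbT oj.
apply/idP/idP; last first.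
  by apply: infix_trans; rewrite -cat1s -cats1; apply: infix_infix.
(* For even [j], [Kn j.+1] begins and ends with [b]; in [psi w] it is thus bordered by [a] on both
   sides, which completes it to [psi (Kn j)]. *)
have [k Ek] : exists s, Kn j.+1 = b :: s by apply: Kn_odd_head.
have [k' Ek'] : exists s, Kn j.+1 = rcons s b.
  by exists (rev k); rewrite -rev_Kn Ek rev_cons.
case/infixP => s [t E]; apply/infixP.
have [s' Es] : exists s', s = rcons s' a.
  by apply: (@psi_before_b w _ (k ++ t)); rewrite E Ek.
have [t' Et] : exists t', t = a :: t'.
  by apply: (@psi_after_b w (s ++ k')); rewrite E Ek' cat_rcons catA.
by exists s', t'; rewrite E Es Et -!cats1 /= -!catA.
Qed.

(** Descend through [psi]. As [Kn 0] is [psi [::]], an index [i] above [j] would end with a kernel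
    word inside the empty word. *)
Lemma infix_Kn_leq i j : infix (Kn i) (Kn j) -> i <= j.
Proof.
elim: i j => // i IH [|j].
  rewrite Kn0 -[[:: a]]/(psi [::]) infix_Kn_psi infixs0.
  by move/eqP/Kn_neq0.
move=> H; apply: IH; rewrite -infix_Kn_psi KnS; case: ifP => // _.
by apply: infix_trans H _; rewrite -cat1s -cats1; apply: infix_infix.
Qed.

(** * Kernels of words *)

Definition is_ker j w := infix (Kn j) w /\ forall i, infix (Kn i) w -> i <= j.

Lemma KerP j w : Ker w = Kn j <-> is_ker j w.
Proof.
have toK (m : int) : (-1 <= m)%R -> exists i, m = (i%:Z - 1)%R.
  by move=> lem; exists `|(m + 1)%R|%N; lia.
rewrite /Ker; case: xgetP => [v _ [m [/toK[i ->{m}] infi maxi ->]]|none].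
  have keri : is_ker i w.
    split=> // k infk; suff : (k%:Z - 1 <= i%:Z - 1)%R by lia.
    by apply: maxi => //; lia.
  rewrite KnE; split=> [E|[infj maxj]].
    suff <- : i = j by [].
    by apply/eqP; rewrite eqn_leq !infix_Kn_leq ?E ?infix_refl.
  by congr Kn; apply/eqP; rewrite eqn_leq maxj // keri.2.
(* Here [Ker w] is the default [[::]], which is no kernel word. *)
split=> // -[infj maxj]; case: (none (Kn j)); exists (j%:Z - 1)%R; split=> //.
  lia.
move=> k /toK[i ->] /maxj; lia.
Qed.

Lemma is_ker_psi j w : is_ker j.+1 (psi w) <-> is_ker j w.
Proof.
split=> -[infj maxj]; split.
- by rewrite -infix_Kn_psi.
- by move=> i; rewrite -infix_Kn_psi => /maxj.
- by rewrite infix_Kn_psi.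
- by case=> // i; rewrite infix_Kn_psi => /maxj.
Qed.

Lemma is_ker_cons_rcons j w s : rev w = w -> w = b :: s ->
  is_ker j.+1 (a :: rcons w a) <-> is_ker j.+1 w.
Proof.
move=> rw Ew; split=> -[infj maxj]; split.
- by rewrite -(infix_Kn_cons_rcons _ rw Ew).
- by case=> // i; rewrite -(infix_Kn_cons_rcons _ rw Ew) => /maxj.
- by rewrite (infix_Kn_cons_rcons _ rw Ew).
- by case=> // i; rewrite (infix_Kn_cons_rcons _ rw Ew) => /maxj.
Qed.

Lemma is_ker0 w : is_ker 0 w <-> w = [:: a].
Proof.
split=> [[infw maxw]|->]; last first.
  by rewrite -Kn0; split=> [|i]; [exact: infix_refl | exact: infix_Kn_leq].
have nb : b \notin w.
  apply/negP => bw; have := maxw 1; rewrite Kn1.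
  by case/splitPr: bw => u v; move/(_ (infix_infix u [:: b] v)).
have allw : w = nseq (size w) a.
  by apply/all_pred1P/allP => -[] // bw; rewrite bw in nb.
move: infw maxw; rewrite allw; case: (size w) => [|[|n]] // _.
by move/(_ 2); rewrite Kn2 => /(_ (prefix_infix [:: a; a] (nseq n a))).
Qed.

(** * Ends of occurrences in the Fibonacci sequence *)

Definition L n := size (sigma (pref fib n)).

Lemma prefS u n : pref u n.+1 = rcons (pref u n) (u n.+1).
Proof. by rewrite /pref -(addn1 n) iotaD map_cat cats1 add1n addn1. Qed.

(** The image of the next letter begins with [a] in either case. *)
Lemma psi_pref n : psi (pref fib n) = pref fib (L n).+1.
Proof.
have := fib_fixed n.+1; rewrite prefS sigma_rcons.
have [t' ->] : exists t', sigma [:: fib n.+1] = a :: t'.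
  by case: (fib n.+1); eexists.
rewrite size_cat /= -/(L n) addnS -cat_rcons => E.
have := congr1 (take (L n).+1) E; rewrite take_size_cat ?size_rcons //.
rewrite /psi cats1 => ->.
have /prefixP[r ->] := pref_prefix fib (leq_addr (size t') (L n).+1).
by rewrite take_size_cat ?size_pref.
Qed.

Lemma ends_atP w n : reflect (exists s, pref fib n = s ++ w) (ends_at w n).
Proof.
apply: (iffP andP) => [[le /eqP->]|[s E]].
  exists (pref fib (n - size w)).
  by rewrite /pref -[in LHS](subnK le) iotaD map_cat add1n.
have := congr1 size E; rewrite size_pref size_cat => En; split; first lia.
have -> : n - size w = size s by lia.
move: E; rewrite En /pref iotaD map_cat => /eqP.
by rewrite eqseq_cat ?size_map ?size_iota // add1n => /andP[_ /eqP->].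
Qed.

Lemma LS n : L n.+1 = L n + (if fib n.+1 is a then 2 else 1).
Proof.
rewrite /L prefS sigma_rcons size_cat.
by case: (fib n.+1).
Qed.

Lemma L_ge n : n <= L n.
Proof. by rewrite -[X in X <= _](size_pref fib) size_sigma. Qed.

Lemma ltL m n : (L m < L n) = (m < n).
Proof.
apply: leqW_mono; apply: leq_mono; apply: homo_ltn; first exact: ltn_trans.
by move=> k; rewrite LS; case: (fib _); lia.
Qed.

Lemma ends_at_psi v N :
  ends_at (psi v) N <-> exists2 n, N = (L n).+1 & ends_at v n.
Proof.
split=> [/ends_atP[s E]|[n -> /ends_atP[s E]]]; last first.
  by apply/ends_atP; exists (sigma s); rewrite -psi_pref E psi_cat.
(* The prefix of length [N] need not be an image, but [psi (pref fib N)] is one and extends it. *)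
have [t Et] : exists t, psi (pref fib N) = s ++ psi v ++ t.
  have : prefix (pref fib N) (psi (pref fib N)).
    by rewrite psi_pref; apply: pref_prefix; apply: leqW; apply: L_ge.
  by case/prefixP=> t ->; exists t; rewrite E -catA.
have [h Eh] := psi_head v.
have [w1 [w2 [E1 E2 E3]]] : exists w1 w2,
    [/\ pref fib N = w1 ++ w2, s = sigma w1 & a :: h ++ t = psi w2].
  by apply: psi_cut; rewrite Et Eh.
have [w3 [E4 _]] : exists w3, w2 = v ++ w3 /\ a :: t = psi w3.
  by apply: psi_strip; rewrite -E3 -cat_cons -Eh /psi -catA.
have Ev : pref fib (size (w1 ++ v)) = w1 ++ v.
  have le : size (w1 ++ v) <= N.
    by rewrite -[X in _ <= X](size_pref fib) E1 E4 catA !size_cat; lia.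
  have /prefixP[r Er] := pref_prefix fib le.
  move: E1; rewrite E4 Er catA => /eqP.
  by rewrite eqseq_cat ?size_pref // => /andP[/eqP].
exists (size (w1 ++ v)); last by apply/ends_atP; exists w1.
have := congr1 size E; rewrite size_pref => ->.
by rewrite -[RHS](size_pref fib) -psi_pref Ev psi_cat E2.
Qed.

(** The empty word ends at every position, 0 included. *)
Lemma ends_at_a N : ends_at [:: a] N <-> exists n, N = (L n).+1.
Proof.
rewrite -[[:: a]]/(psi [::]) ends_at_psi; split=> -[n]; first by exists n.
by exists n => //; apply/ends_atP; exists (pref fib n); rewrite cats0.
Qed.

Lemma ends_at_rcons w x n : ends_at (rcons w x) n -> fib n = x.
Proof.
case/ends_atP => s E; have := congr1 size E.
rewrite size_pref size_cat size_rcons addnS => En.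
by move: E; rewrite En -rcons_cat prefS => /rcons_inj [_].
Qed.

Lemma ends_at_cons_rcons w s n : rev w = w -> w = b :: s ->
  ends_at (a :: rcons w a) n.+1 = ends_at w n.
Proof.
move=> rw Ew; have E : w = rcons (rev s) b by rewrite -rw Ew rev_cons.
apply/ends_atP/ends_atP => -[u Eu].
  exists (rcons u a); move: Eu; rewrite -cat_rcons -rcons_cat.
  by rewrite prefS => /rcons_inj [-> _].
(* Embedding the prefix in an image of [psi] shows that [a] stands on both sides of [w]. *)
have [r Er] : exists r, pref fib (L n).+1 = pref fib n.+1 ++ r.
  by apply/prefixP; apply: pref_prefix; apply: L_ge.
have Ep : psi (pref fib n) = u ++ w ++ fib n.+1 :: r.
  by rewrite psi_pref Er prefS cat_rcons Eu -catA.
have [_ [Ex _]] : exists t, fib n.+1 :: r = a :: t.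
  apply: (@psi_after_b (pref fib n) (u ++ rev s)).
  by rewrite Ep {1}E cat_rcons -catA.
have [u' Eu'] : exists u', u = rcons u' a.
  apply: (@psi_before_b (pref fib n) _ (s ++ fib n.+1 :: r)).
  by rewrite Ep {1}Ew.
by exists u'; rewrite prefS Ex Eu Eu' cat_rcons rcons_cat.
Qed.

(** * Counting occurrences *)

(** An increasing bijection between ends preserves ranks. Monotonicity is asked at positive
    positions only, since the map used in [P_a] agrees at 0 and 1. *)
Lemma P_transport w w' (g : nat -> nat) p n :
  (forall i j, 0 < i -> 0 < j -> (g i < g j) = (i < j)) ->
  (forall i, 0 < i -> 0 < g i) ->
  (forall N, 0 < N ->
    ends_at w' N <-> exists k, [/\ 0 < k, N = g k & ends_at w k]) ->
  0 < n -> ends_at w n -> count (ends_at w) (iota 1 n) = p ->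
  ends_at w' (g n) /\ count (ends_at w') (iota 1 (g n)) = p.
Proof.
move=> gm g0 H n0 en <-; split; first by apply/H; [exact: g0 | exists n].
have gle i j : 0 < i -> 0 < j -> (g i <= g j) = (i <= j).
  by move=> i0 j0; rewrite leqNgt gm // -leqNgt.
rewrite -!size_filter -[RHS](size_map g).
apply: perm_size; apply: uniq_perm.
- exact/filter_uniq/iota_uniq.
- rewrite map_inj_in_uniq; first exact/filter_uniq/iota_uniq.
  move=> i j; rewrite !mem_filter !mem_iota => /and3P[_ i0 _] /and3P[_ j0 _] E.
  by apply/eqP; rewrite eqn_leq -(gle _ _ i0 j0) -(gle _ _ j0 i0) E leqnn.
move=> N; rewrite mem_filter mem_iota add1n ltnS; apply/and3P/mapP.
  move=> [eN N0 leN]; have [k [k0 Nk ek]] := (H N N0).1 eN.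
  by exists k => //; rewrite mem_filter mem_iota ek k0 add1n ltnS -gle // -Nk.
case=> k; rewrite mem_filter mem_iota add1n ltnS => /and3P[ek k0 lek] ->.
split; [|exact: g0|by rewrite gle].
by apply/H; [exact: g0 | exists k].
Qed.

Lemma count_iotaS (e : pred nat) k :
  count e (iota 1 k.+1) = count e (iota 1 k) + e k.+1.
Proof.
by rewrite -[in iota 1 k.+1](addn1 k) iotaD count_cat add1n /= addn0.
Qed.

Lemma leq_count_iota (e : pred nat) m n :
  m <= n -> count e (iota 1 m) <= count e (iota 1 n).
Proof. by move=> le; rewrite -(subnKC le) iotaD count_cat leq_addr. Qed.

(** The count grows at every end, so at most one position satisfies the condition defining [P]. *)
Lemma P_eq w p n : ends_at w n -> count (ends_at w) (iota 1 n) = p -> P w p = n.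
Proof.
move=> en cn; rewrite /P; case: xgetP => [m _ [em cm]|/(_ n) []//].
have lt i j : ends_at w j -> i < j ->
    count (ends_at w) (iota 1 i) < count (ends_at w) (iota 1 j).
  case: j => // j ej ij; rewrite count_iotaS ej addn1 ltnS.
  exact: leq_count_iota.
by have [/(lt _ _ en)|/(lt _ _ em)|] := ltngtP m n; rewrite ?cn ?cm ?ltnn.
Qed.

Definition recurrent w := forall N, exists2 n, N < n & ends_at w n.

(** The count rises by at most one per position, so the least [n] where it reaches [p] is an end of
    rank exactly [p]. *)
Lemma recurrent_P w p : recurrent w -> 0 < p ->
  [/\ 0 < P w p, ends_at w (P w p) & count (ends_at w) (iota 1 (P w p)) = p].
Proof.
move=> rw p0.
have unb : exists n, p <= count (ends_at w) (iota 1 n).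
  elim: p {p0} => [|q [n Hn]]; first by exists 0.
  have [[|m] // ltm em] := rw n; exists m.+1; rewrite count_iotaS em addn1 ltnS.
  by apply: leq_trans Hn (leq_count_iota _ _).
case: (ex_minnP unb) => -[|n] Hn minn; first by move: Hn; rewrite leqNgt p0.
have lt : count (ends_at w) (iota 1 n) < p.
  by rewrite ltnNge; apply/negP => /minn; rewrite ltnn.
have en : ends_at w n.+1.
  by move: Hn; rewrite count_iotaS; case: (ends_at _ _); lia.
have cn : count (ends_at w) (iota 1 n.+1) = p.
  by move: Hn; rewrite count_iotaS en; lia.
by rewrite (P_eq en cn).
Qed.

Lemma recurrent_infix v w : infix v w -> recurrent w -> recurrent v.
Proof.
case/infixP => s [t ->] rw N; have [n ltn /ends_atP[u E]] := rw (N + size t).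
exists (n - size t); first lia.
have := congr1 size E; rewrite size_pref !size_cat => En.
have /prefixP[r Er] : prefix (pref fib (n - size t)) (pref fib n).
  by apply: pref_prefix; apply: leq_subr.
apply/ends_atP; exists (u ++ s); move: E; rewrite Er !catA => /eqP.
rewrite eqseq_cat; first by case/andP => /eqP.
by rewrite size_pref En !size_cat !addnA addnK.
Qed.

Lemma recurrent_psi w : recurrent w -> recurrent (psi w).
Proof.
move=> rw N; have [n ltn en] := rw N; exists (L n).+1.
  by rewrite ltnS; apply: leq_trans (ltnW ltn) (L_ge n).
by apply/ends_at_psi; exists n.
Qed.

Lemma recurrent_a : recurrent [:: a].
Proof.
move=> N; exists (L N).+1; first by rewrite ltnS L_ge.
by apply/ends_at_a; exists N.
Qed.

(** Every factor lies in some F_n, and F_(n+1) is a prefix of psi F_n; hence recurrence spreads from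
    F_0 = a. *)
Lemma factor_recurrent w : factor w -> recurrent w.
Proof.
case=> n /ends_atP[s E].
have /prefixP[r Er] : prefix (pref fib n) (Fword n%:Z).
  by rewrite -fib_pref; apply: pref_prefix; apply: ltnW; apply: size_Fword.
apply: (@recurrent_infix _ (Fword n%:Z)).
  by rewrite Er E -catA; apply: infix_infix.
elim: (n) => [|k IH]; first exact: recurrent_a.
apply: recurrent_infix (recurrent_psi IH).
exact: prefix_infix.
Qed.

Lemma recurrent_factor w : recurrent w -> factor w.
Proof. by move/(_ 0) => [n _ en]; exists n. Qed.

Lemma factor_psi v : factor (psi v) <-> factor v.
Proof.
split=> [[N /ends_at_psi[n _ en]]|[n en]]; first by exists n.
by exists (L n).+1; apply/ends_at_psi; exists n.
Qed.

Lemma factor_P w p : factor w -> 0 < p ->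
  [/\ 0 < P w p, ends_at w (P w p) & count (ends_at w) (iota 1 (P w p)) = p].
Proof. by move/factor_recurrent/recurrent_P; apply. Qed.

Lemma ends_at_gt0 w n : w <> [::] -> ends_at w n -> 0 < n.
Proof. by case: w => // x w _ /andP[le _]; apply: leq_trans le. Qed.

Lemma P_psi v p : v <> [::] -> factor v -> 0 < p ->
  P (psi v) p = (L (P v p)).+1.
Proof.
move=> v0 fv p0; have [n0 en cn] := factor_P fv p0.
have [] // := @P_transport v (psi v) (fun n => (L n).+1) p _ _ _ _ n0 en cn.
- by move=> i j _ _; rewrite ltnS ltL.
- move=> N _; rewrite ends_at_psi; split=> [[k -> ek]|[k [_ -> ek]]].
    by exists k; split=> //; apply: ends_at_gt0 ek.
  by exists k.
by move=> *; apply: P_eq.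
Qed.

Lemma P_cons_rcons w s p : rev w = w -> w = b :: s -> factor w -> 0 < p ->
  P (a :: rcons w a) p = (P w p).+1.
Proof.
move=> rw Ew fw p0; have [n0 en cn] := factor_P fw p0.
have [] // := @P_transport w (a :: rcons w a) S p _ _ _ _ n0 en cn.
  case=> // N _; rewrite (ends_at_cons_rcons _ rw Ew).
  split=> [eN|[k [_ [->]]]] //; exists N; split=> //.
  by apply: ends_at_gt0 eN; rewrite Ew.
by move=> *; apply: P_eq.
Qed.

(** Transport from the empty word. The predecessor in the map accounts for its end at 0, which the
    count omits. *)
Lemma P_a n : P [:: a] n.+1 = (L n).+1.
Proof.
have := @P_transport [::] [:: a] (fun n => (L n.-1).+1) n.+1 n.+1.
case=> //.
- by move=> [|i] [|j] // _ _; rewrite ltnS ltL.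
- move=> N _; rewrite ends_at_a; split=> [[k ->]|[[|k] [// _ -> _]]].
    by exists k.+1.
  by exists k.
- rewrite (eq_count (a2 := predT)) ?count_predT ?size_iota //.
by move=> *; apply: P_eq.
Qed.

Lemma factor_a : factor [:: a].
Proof. exact: recurrent_factor recurrent_a. Qed.

Lemma factor_infix v w : infix v w -> factor w -> factor v.
Proof.
move=> vw /factor_recurrent rw.
exact: recurrent_factor (recurrent_infix vw rw).
Qed.

Lemma factor_b : factor [:: b].
Proof. exact: factor_infix ((factor_psi [:: a]).2 factor_a). Qed.

(** The word [aba] is both [psi [:: a]] and [b] bordered by [a]; compute the end of its [p]-th
    occurrence in both ways. *)
Lemma P_b p : 0 < p -> P [:: b] p = L (P [:: a] p).
Proof.
move=> p0; apply: succn_inj.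
rewrite -(P_psi _ factor_a p0) // -(P_cons_rcons (s := [::])) //.
exact: factor_b.
Qed.

(* The map n |-> L n + 1 accounts for psi v. Stripping its end letters gives
   b...b iff v ends in a, that is iff fib n = a, and moves the end to L n. *)
Definition T (S : set nat) : set nat :=
  [set N | exists2 n, S n & N = (L n).+1 \/ fib n = a /\ N = L n]%classic.

(** * Palindromes with a given kernel *)

Lemma palindrome_psi w : factor w -> rev w = w -> ohead w = Some a ->
  w = [:: a] \/ exists2 v, w = psi v & v <> [::] /\ rev v = v.
Proof.
case: w => // x w fw rw [Ex]; rewrite {x}Ex in fw rw *.
case/lastP: w fw rw => [|w y] fw rw; first by left.
right; move: rw; rewrite rev_cons rev_rcons rcons_cons => -[Ey rw].
rewrite {y}Ey in fw rw *.
have [n /ends_atP[s E]] := fw; have /esym Ep := psi_pref n.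
have /prefixP[r Er] := pref_prefix fib (leqW (L_ge n)).
(* Cut [psi (pref fib n)] before the first letter of the palindrome, then before its last. *)
move: Ep; rewrite Er E -catA cat_cons => /esym /psi_cut [w1 [w2 [_ _ E2]]].
move: E2; rewrite cat_rcons -cat_cons => /esym /psi_cut [v [v' [_ Ev _]]].
exists v; first by rewrite /psi -Ev cats1.
have psiv : psi v = a :: rcons w a by rewrite /psi -Ev cats1.
split; first by move=> v0; move: psiv; rewrite v0; case: (w).
apply: psi_inj; rewrite -rev_psi psiv rev_cons rev_rcons rcons_cons.
by rewrite rw.
Qed.

Definition pal_ker j w := [/\ w <> [::], factor w, rev w = w & is_ker j w].

Lemma ksetE j p : kset (j%:Z - 1)%R p = [set P w p | w in pal_ker j]%classic.
Proof.
rewrite /kset KnE; congr image; apply/seteqP; split=> w /=.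
  by case=> -[w0 fw rw] /KerP kw.
by case=> w0 fw rw /KerP kw.
Qed.

Lemma kset0 p : kset (0%:Z - 1)%R p = [set P [:: a] p]%classic.
Proof.
rewrite ksetE; apply/seteqP; split=> n /=.
  by case=> w [_ _ _ /is_ker0 ->].
move=> ->; exists [:: a] => //; split=> //; first exact: factor_a.
exact/is_ker0.
Qed.

Lemma pal_ker_psi j v : v <> [::] -> pal_ker j.+1 (psi v) <-> pal_ker j v.
Proof.
move=> v0; split=> -[_ fv rv kv]; split=> //.
- exact/factor_psi.
- by apply: psi_inj; rewrite -rev_psi.
- exact/is_ker_psi.
- by have [t ->] := psi_head v.
- exact/factor_psi.
- by rewrite rev_psi rv.
- exact/is_ker_psi.
Qed.

Lemma pal_kerS j w : pal_ker j.+1 w -> ohead w = Some a ->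
  exists2 v, w = psi v & pal_ker j v.
Proof.
move=> pw hw; have [_ fw rw kw] := pw.
have [wa|[v Ew [v0 _]]] := palindrome_psi fw rw hw; last first.
  by exists v => //; apply/pal_ker_psi; rewrite -?Ew.
by case: kw; rewrite wa -Kn0 => /infix_Kn_leq.
Qed.

(** This reduces palindromes beginning with [b] to those beginning with [a], which desubstitute. *)
Lemma pal_ker_cons_rcons j w s : rev w = w -> w = b :: s ->
  pal_ker j.+1 (a :: rcons w a) <-> pal_ker j.+1 w.
Proof.
move=> rw Ew; split=> -[_ fw _ kw]; split=> //.
- by rewrite Ew.
- by apply: factor_infix fw; rewrite -cat1s -cats1; apply: infix_infix.
- exact/(is_ker_cons_rcons _ rw Ew).
- by have [n en] := fw; exists n.+1; rewrite (ends_at_cons_rcons _ rw Ew).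
- by rewrite rev_cons rev_rcons rw.
- exact/(is_ker_cons_rcons _ rw Ew).
Qed.

Lemma ksetS j p : 0 < p -> kset (j.+1%:Z - 1)%R p = T (kset (j%:Z - 1)%R p).
Proof.
move=> p0; rewrite !ksetE; apply/seteqP; split=> N /=.
  case=> w pw <-{N}; have [w0 fw rw _] := pw.
  case Ew: w w0 => [|[] s] // _.
    have [|v Ev pv] := pal_kerS pw; first by rewrite Ew.
    have [v0 fv _ _] := pv; exists (P v p); first by exists v.
    by left; rewrite -P_psi // -Ev Ew.
  have [//|v Ev pv] := pal_kerS ((pal_ker_cons_rcons j rw Ew).2 pw).
  have [v0 fv rv _] := pv; exists (P v p); first by exists v.
  right; split; last first.
    by apply: succn_inj; rewrite -Ew -(P_cons_rcons rw Ew) // Ev P_psi.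
  have [_ ev _] := factor_P fv p0.
  (* [psi v] begins with [ab], so [v] begins with [a] and, being a palindrome, ends with [a]. *)
  have [v' E] : exists v', v = rcons v' a.
    case: (v) v0 Ev rv => [|[] t] // _; last first.
      by rewrite Ew /psi sigma_cons; case: t => [|[]].
    by rewrite rev_cons => _ <-; exists (rev t).
  by apply: ends_at_rcons (v') _ _ _; rewrite -E.
case=> n [v pv <-{n}]; have [v0 fv rv _] := pv.
case=> [->|[fa ->]].
  by exists (psi v); [exact/pal_ker_psi | exact: P_psi].
have [v' E] : exists v', v = a :: v'.
  have [_ ev _] := factor_P fv p0.
  case/lastP: (v) v0 rv ev fa => [|t x] // _ rt /ends_at_rcons -> Ex.
  by exists (rev t); rewrite -rt Ex rev_rcons.
(* This is [psi v] without its two end letters. *)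
pose w := b :: sigma v'.
have Ew : psi v = a :: rcons w a by rewrite E /w -cats1.
have rw : rev w = w.
  have := rev_psi v; rewrite rv Ew rev_cons rev_rcons rcons_cons.
  by case=> H; apply: (@rcons_injl _ a).
have pw : pal_ker j.+1 w.
  by apply/(pal_ker_cons_rcons _ rw erefl); rewrite -Ew; apply/pal_ker_psi.
exists w => //; have [_ fw _ _] := pw.
by apply: succn_inj; rewrite -(P_cons_rcons rw erefl) // -Ew P_psi.
Qed.

(** * The recurrence *)

Lemma TU A B : T (A `|` B)%classic = (T A `|` T B)%classic.
Proof.
apply/seteqP; split=> N.
  by case=> n [An|Bn] H; [left | right]; exists n.
by case=> -[n An H]; exists n => //; [left | right].
Qed.

Lemma T1 n :
  T [set n]%classic =
    (if fib n is a then [set L n; (L n).+1] else [set (L n).+1])%classic.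
Proof.
apply/seteqP; split=> N /=.
  by case=> _ -> [->|[-> ->]]; [case: fib => //; right | left].
by case fn: (fib n); [case|] => ->; exists n => //; [right | left | left].
Qed.

Lemma kset_rec j p : 0 < p ->
  kset (j.+2%:Z - 1)%R p =
  (kset (j%:Z - 1)%R (P [:: b] p).+1
    `|` kset (j.+1%:Z - 1)%R (P [:: a] p).+1)%classic.
Proof.
move=> p0; elim: j => [|j IH]; last first.
  by rewrite ksetS // IH TU -!ksetS.
(* With n = P(a,p), the left side is [T] of {L n, L n + 1}. Since [fib (L n)] is [b], the first
   point gives only L(L n) + 1 = P(a, P(b,p) + 1); the second is P(a, n + 1), whose image under [T]
   is the other set. *)
rewrite !(ksetS _ p0) ksetS // !kset0 P_b // !P_a.
have [_ ea _] := factor_P factor_a p0.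
have [_ eb _] := factor_P factor_b p0; rewrite P_b // in eb.
have fa : fib (P [:: a] p) = a := @ends_at_rcons [::] a _ ea.
have fb : fib (L (P [:: a] p)) = b := @ends_at_rcons [::] b _ eb.
by rewrite T1 fa TU T1 fb.
Qed.

Theorem mainTheorem7 (m : int) (p : nat) (hm : (1 <= m)%R) (hp : 1 <= p) :
  kset m p =
  (kset (m - 2)%R (P [:: b] p + 1) `|` kset (m - 1)%R (P [:: a] p + 1))%classic.
Proof.
have [j ->] : exists j : nat, m = (j.+2%:Z - 1)%R.
  by exists `|(m - 1)%R|%N; lia.
rewrite (_ : _ - 2 = j%:Z - 1)%R; last lia.
rewrite (_ : _ - 1 - 1 = j.+1%:Z - 1)%R; last lia.
by rewrite !addn1 kset_rec.
Qed.
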